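(* Let $A\in\mathbb{R}^{n\times n}$ be symmetric, let $f$ be a real function defined on the spectrum of $A$, let $C_1,\dots,C_m$ be a partition of $\{1,\dots,n\}$, let $\ell\in\{1,\dots,m\}$, and let $\boldsymbol{w}_\ell=\sum_{i\in C_\ell}X_i\boldsymbol{e}_i$ with $X_i$, $i\in C_\ell$, i.i.d. real random variables. Put $V_\ell:=\mathbb{V}[\boldsymbol{w}_\ell^Tf(A)\boldsymbol{w}_\ell]$. (1) If $\boldsymbol{w}_\ell$ is a Rademacher probing vector (each $X_i$ takes the values $\pm1$ with probability $\tfrac12$ each), then $$V_\ell=2\|\operatorname{Off}([f(A)]_{C_\ell})\|_F^2=2\sum_{\substack{i,j\in C_\ell\\ i\ne j}}|[f(A)]_{ij}|^2.$$ (2) If $\boldsymbol{w}_\ell$ is a Gaussian probing vector (each $X_i$ is standard normal), then $$V_\ell=2\|[f(A)]_{C_\ell}\|_F^2=2\sum_{i,j\in C_\ell}|[f(A)]_{ij}|^2.$$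
   Context: For symmetric $A$, $f(A)$ is the matrix function defined through the spectral decomposition. $\mathbb{V}$ denotes variance. $[M]_{ij}$ is the $(i,j)$ entry of $M$, $[M]_{\mathcal{I}}$ is the submatrix of $M$ with rows and columns indexed by $\mathcal{I}$, $\operatorname{Off}(M)$ is the off-diagonal part of $M$ (diagonal replaced by zeros), and $\|\cdot\|_F$ is the Frobenius norm. $\boldsymbol{e}_i$ is the $i$th canonical basis vector of $\mathbb{R}^n$. *)

(* Defs.v *)
From HB Require Import structures.
From mathcomp Require Import all_boot all_order all_algebra.
From mathcomp Require Import complex.
From mathcomp Require Import all_classical all_reals all_analysis.
From mathcomp Require Import ring lra.

Set Implicit Arguments.
Unset Strict Implicit.
Unset Printing Implicit Defensive.

Import Order.TTheory GRing.Theory Num.Theory.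
Import numFieldNormedType.Exports.

Local Open Scope classical_set_scope.
Local Open Scope ring_scope.

Definition spectral_decomposition (R : realType) (n : nat)
    (A Q : 'M[R]_n) (d : 'rV[R]_n) : Prop :=
  Q^T *m Q = 1%:M /\ A = Q *m diag_mx d *m Q^T.

(* f(A) := Q diag(f(d)) Q^T for a spectral decomposition A = Q diag(d) Q^T.
   One exists when A is symmetric (spectral_decomposition_exists) and the value
   does not depend on it (matfunE).  Only the values of f on the spectrum of A
   matter (eq_matfun), so a total f : R -> R stands for a function on the
   spectrum. *)
Definition matfun (R : realType) (n : nat) (f : R -> R) (A : 'M[R]_n) :
    'M[R]_n :=
  xget 0 [set M : 'M[R]_n | exists (Q : 'M[R]_n) (d : 'rV[R]_n),
    spectral_decomposition A Q d /\ M = Q *m diag_mx (map_mx f d) *m Q^T].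

Definition frobenius_norm (R : realType) (m n : nat) (M : 'M[R]_(m, n)) : R :=
  Num.sqrt (\sum_(i < m) \sum_(j < n) `|M i j| ^+ 2).

Definition Off (R : realType) (n : nat) (M : 'M[R]_n) : 'M[R]_n :=
  \matrix_(i < n, j < n) (if i == j then 0 else M i j).

Definition principal_submx (R : realType) (n : nat) (C : {set 'I_n})
    (M : 'M[R]_n) : 'M[R]_#|C| :=
  mxsub enum_val enum_val M.

(* C_0, ..., C_(m-1) is an indexed partition into nonempty cells; injectivity
   rules out C_k = C_l for k != l, which the image set alone would not see. *)
Definition is_indexed_partition (m n : nat) (C : 'I_m -> {set 'I_n}) : Prop :=
  injective C /\ finset.partition [set C l | l : 'I_m]%SET [set: 'I_n]%SET.

Section Probability.
Context (d : measure_display) (T : measurableType d) (R : realType).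
Variable P : probability T R.

Definition mutually_independent (I : finType) (C : {set I})
    (X : I -> {RV P >-> R}) : Prop :=
  forall (J : {set I}) (B : I -> set R), J \subset C ->
    (forall i, i \in J -> measurable (B i)) ->
    P (\bigcap_(i in [set` J]) (X i @^-1` B i)) =
    (\prod_(i in J) P (X i @^-1` B i))%E.

Definition identically_distributed (I : finType) (C : {set I})
    (X : I -> {RV P >-> R}) : Prop :=
  forall i j, i \in C -> j \in C -> forall B : set R, measurable B ->
    distribution P (X i) B = distribution P (X j) B.

Definition iid (I : finType) (C : {set I}) (X : I -> {RV P >-> R}) : Prop :=
  mutually_independent C X /\ identically_distributed C X.

Definition rademacher (X : {RV P >-> R}) : Prop :=
  P (X @^-1` [set 1]) = (2^-1)%:E /\ P (X @^-1` [set -1]) = (2^-1)%:E.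

Definition standard_normal (X : {RV P >-> R}) : Prop :=
  forall B : set R, measurable B -> distribution P X B = normal_prob 0 1 B.

Definition probing_vector (n : nat) (C : {set 'I_n})
    (X : 'I_n -> {RV P >-> R}) (t : T) : 'cV[R]_n :=
  \sum_(i in C) X i t *: delta_mx i 0.

End Probability.

Definition quadratic_form (R : realType) (n : nat) (M : 'M[R]_n)
    (w : 'cV[R]_n) : R :=
  (w^T *m M *m w) 0 0.

Section MatfunTheory.
Variable R : realType.

Lemma spectral_decomposition_uniq n (f g : R -> R) (A Q P : 'M[R]_n) d e :
  (forall x, eigenvalue A x -> f x = g x) ->
  spectral_decomposition A Q d -> spectral_decomposition A P e ->
  Q *m diag_mx (map_mx f d) *m Q^T = P *m diag_mx (map_mx g e) *m P^T.
Proof.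
move=> fg [QQ AQ] [PP AP].
have QQ' : Q *m Q^T = 1%:M by apply: mulmx1C.
have PP' : P *m P^T = 1%:M by apply: mulmx1C.
have [S Sdef] : exists S, S = P^T *m Q by exists (P^T *m Q).
have SE : S *m diag_mx d = diag_mx e *m S.
  have: P^T *m A *m Q = P^T *m A *m Q by [].
  rewrite {1}AQ AP !mulmxA PP mul1mx -(mulmxA _ Q^T Q) QQ mulmx1.
  by rewrite Sdef mulmxA.
have eigd j : eigenvalue A (d 0 j).
  apply/eigenvalueP; exists (row j Q^T).
    rewrite AQ -!row_mul !mulmxA QQ mul1mx.
    by rewrite mul_diag_mx; apply/rowP => k; rewrite !mxE.
  apply/eqP => /(congr1 (mulmx^~ Q)); rewrite -row_mul QQ mul0mx.
  by move/rowP/(_ j); rewrite !mxE eqxx => /eqP; rewrite oner_eq0.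
have SF : S *m diag_mx (map_mx f d) = diag_mx (map_mx g e) *m S.
  apply/matrixP => i j; move/matrixP/(_ i j): SE.
  rewrite !mul_mx_diag !mul_diag_mx !mxE.
  have [->|S0] := eqVneq (S i j) 0; first by rewrite !mul0r !mulr0.
  rewrite mulrC => /(mulIf S0) dj; rewrite mulrC -dj; congr (_ * _).
  exact/fg/eigd.
have QE : Q = P *m S by rewrite Sdef mulmxA PP' mul1mx.
rewrite {1}QE -(mulmxA P S) SF mulmxA -mulmxA; congr (_ *m _).
by rewrite Sdef -mulmxA QQ' mulmx1.
Qed.

Lemma matfunE n (f : R -> R) (A Q : 'M[R]_n) d :
  spectral_decomposition A Q d ->
  matfun f A = Q *m diag_mx (map_mx f d) *m Q^T.
Proof.
move=> AQ; rewrite /matfun; case: xgetP => [M _ [P [e [AP ->]]]|noM].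
  exact: (spectral_decomposition_uniq (fun _ _ => erefl) AP AQ).
by case: (noM (Q *m diag_mx (map_mx f d) *m Q^T)); exists Q, d.
Qed.

Lemma symmetric_eigenvalue n (A : 'M[R]_n.+1) : A^T = A ->
  exists x, eigenvalue A x.
Proof.
move=> Asym; pose B := map_mx (complex.real_complex R) A.
have Bherm : B \is hermsymmx.
  apply: realsym_hermsym.
    apply/is_hermitianmxP; rewrite expr0 scale1r map_mx_id //.
    by rewrite map_trmx Asym.
  by apply/mxOverP => i j; rewrite mxE complex.complex_real.
pose U := spectralmx B; pose a := spectral_diag B 0 0.
have Uu : U \in unitmx by exact: spectral_unit.
have BE : U *m B = diag_mx (spectral_diag B) *m U.
  have /hermitian_normalmx/orthomx_spectralP BU := Bherm.
  by rewrite [in LHS]BU -mulmxA mulKVmx.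
have Ba : eigenvalue B a.
  apply/eigenvalueP; exists (row 0 U).
    by rewrite -row_mul BE mul_diag_mx; apply/rowP => k; rewrite !mxE.
  apply/eqP => /(congr1 (mulmx^~ (invmx U))); rewrite -row_mul mulmxV // mul0mx.
  by move/rowP/(_ 0); rewrite !mxE eqxx => /eqP; rewrite oner_eq0.
have /mxOverP/(_ 0 0) ar := hermitian_spectral_diag_real Bherm.
exists (complex.Re a); rewrite eigenvalue_root_char.
rewrite -(fmorph_root (complex.real_complex R)) map_char_poly /=.
by have := Ba; rewrite eigenvalue_root_char -[X in root _ X](complex.RRe_real ar).
Qed.

Lemma householder n (v : 'rV[R]_n.+1) : v *m v^T = 1%:M ->
  exists H : 'M[R]_n.+1, [/\ H^T = H, H *m H = 1%:M & delta_mx 0 0 *m H = v].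
Proof.
move=> vv; pose e : 'rV[R]_n.+1 := delta_mx 0 0.
have [u uE] : exists u, u = e - v by exists (e - v).
have ee : e *m e^T = 1%:M.
  by rewrite trmx_delta mul_delta_mx; apply/rowP => i; rewrite !ord1 !mxE.
have [u0|u0] := eqVneq u 0.
  exists 1%:M; rewrite trmx1 !mulmx1; split => //.
  by apply/eqP; rewrite -subr_eq0 -/e -uE u0.
pose s := (u *m u^T) 0 0.
have uuE : u *m u^T = s%:M by rewrite [LHS]mx11_scalar.
have s0 : s != 0.
  apply: contra u0 => /eqP; rewrite /s mxE => s0; apply/eqP/rowP => i.
  rewrite [RHS]mxE; apply/eqP; rewrite -sqrf_eq0; apply/eqP.
  have /psumr_eq0P : forall k, true -> 0 <= u 0 k * u^T k 0.
    by move=> k _; rewrite [u^T _ _]mxE -expr2 sqr_ge0.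
  by move=> /(_ s0 i isT); rewrite [u^T _ _]mxE -expr2.
have euE : (e *m u^T) 0 0 = s / 2.
  have evE : v *m e^T = e *m v^T.
    by rewrite -[LHS]trmxK trmx_mul trmxK; rewrite [in LHS](mx11_scalar (e *m v^T)) tr_scalar_mx -mx11_scalar.
  rewrite /s uE linearB /= !(mulmxBl, mulmxBr) ee vv evE !mxE /=; lra.
exists (1%:M - (2 / s) *: (u^T *m u)); split.
- by rewrite linearB /= linearZ /= trmx1 trmx_mul trmxK.
- have NN : u^T *m u *m (u^T *m u) = s *: (u^T *m u).
    by rewrite -mulmxA (mulmxA u) uuE mul_scalar_mx -scalemxAr.
  rewrite mulmxBl !mulmxBr !mul1mx mulmx1 -scalemxAl -scalemxAr NN !scalerA !mulrA.
  have -> : 2 / s * 2 / s * s = 2 / s + 2 / s :> R by field.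
  by rewrite scalerDl opprB addrK subrK.
- rewrite -/e mulmxBr mulmx1 -scalemxAr mulmxA [e *m _]mx11_scalar euE.
  rewrite mul_scalar_mx scalerA (_ : _ * _ = 1) ?scale1r; last by field.
  by rewrite uE opprB addrC subrK.
Qed.

Lemma spectral_decomposition_exists n (A : 'M[R]_n) : A^T = A ->
  exists Q d, spectral_decomposition A Q d.
Proof.
elim: n A => [|n IHn] A Asym.
  by exists 1%:M, 0; split; apply/matrixP => -[].
have [x /eigenvalueP[w wA w0]] := symmetric_eigenvalue Asym.
have ww : 0 < (w *m w^T) 0 0.
  rewrite lt_def mxE; apply/andP; split; last first.
    by apply: sumr_ge0 => k _; rewrite mxE -expr2 sqr_ge0.
  apply: contra w0 => /eqP s0; apply/eqP/rowP => i.
  rewrite [RHS]mxE; apply/eqP; rewrite -sqrf_eq0; apply/eqP.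
  have /psumr_eq0P : forall k, true -> 0 <= w 0 k * w^T k 0.
    by move=> k _; rewrite [w^T _ _]mxE -expr2 sqr_ge0.
  by move=> /(_ s0 i isT); rewrite [w^T _ _]mxE -expr2.
set s := (w *m w^T) 0 0 in ww.
pose v := (Num.sqrt s)^-1 *: w.
have vv : v *m v^T = 1%:M.
  rewrite /v linearZ /= -scalemxAl -scalemxAr scalerA [w *m _]mx11_scalar -/s.
  rewrite -invfM -expr2 sqr_sqrtr ?ltW // scale_scalar_mx mulVf //.
  by rewrite gt_eqF.
have vA : v *m A = x *: v.
  by rewrite /v -scalemxAl wA !scalerA mulrC.
have [H [Ht HH eH]] := householder vv.
pose B : 'M[R]_(1 + n) := H *m A *m H.
have Bt : B^T = B by rewrite /B !trmx_mul Ht Asym mulmxA.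
have eB : delta_mx 0 0 *m B = x *: delta_mx 0 0 :> 'rV_(1 + n).
  rewrite /B !mulmxA eH vA -scalemxAl; congr (_ *: _).
  by rewrite -eH -mulmxA HH mulmx1.
have B0 j : B 0 j = x * (j == 0)%:R.
  move/rowP/(_ j): eB; rewrite -rowE [LHS]mxE => ->.
  by rewrite !mxE eqxx.
have l0 : lshift n (0 : 'I_1) = 0 :> 'I_(1 + n) by apply/val_inj.
have ulE : ulsubmx B = x%:M.
  apply/matrixP => i j; rewrite !ord1 mxE mxE l0 B0 eqxx.
  by rewrite [RHS]mxE eqxx mulr1 mulr1n.
have urE : ursubmx B = 0.
  by apply/matrixP => i j; rewrite !ord1 mxE mxE l0 B0 [RHS]mxE mulr0.
have dlE : dlsubmx B = 0.
  by rewrite -[LHS]trmxK trmx_dlsub Bt urE trmx0.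
have [|Q [d [QQ BQ]]] := IHn (drsubmx B); first by rewrite trmx_drsub Bt.
pose K : 'M[R]_(1 + n) := block_mx 1%:M 0 0 Q.
have KK : K^T *m K = 1%:M.
  rewrite /K tr_block_mx !trmx0 trmx1 mulmx_block !mulmx0 !mul0mx mulmx1.
  by rewrite QQ !addr0 add0r -scalar_mx_block.
have BE : B = K *m diag_mx (row_mx x%:M d) *m K^T.
  rewrite -[LHS]submxK ulE urE dlE diag_mx_row /K tr_block_mx !trmx0 trmx1.
  rewrite !mulmx_block !mulmx0 !mul0mx !mulmx1 !mul1mx !addr0 !add0r.
  rewrite mul0mx -BQ; congr block_mx.
  by apply/matrixP => i j; rewrite !ord1 !mxE eqxx !mulr1n.
exists (H *m K), (row_mx x%:M d); split.
  by rewrite trmx_mul Ht mulmxA -(mulmxA _ H H) HH mulmx1.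
rewrite trmx_mul Ht !mulmxA -(mulmxA H K) -(mulmxA H _ K^T) -BE /B.
by rewrite !mulmxA HH mul1mx -mulmxA HH mulmx1.
Qed.

Lemma eq_matfun n (f g : R -> R) (A : 'M[R]_n) : A^T = A ->
  (forall x, eigenvalue A x -> f x = g x) -> matfun f A = matfun g A.
Proof.
move=> /spectral_decomposition_exists [Q [d AQ]] fg.
by rewrite !(matfunE _ AQ); exact: (spectral_decomposition_uniq fg AQ AQ).
Qed.

End MatfunTheory.

(* Main.v *)
(* Write V = Var (w^T M w) with M = f(A) symmetric. The entries X_i of w are
   independent with E X = 0, E X^2 = 1 and E X^4 = kappa, so that a product of
   four entries has mean
     E (X_i X_j X_r X_s) = [i=j][r=s] + [i=r][j=s] + [i=s][j=r]
                           + (kappa - 3) [i=j=r=s].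
   Expanding E Q^2 - (E Q)^2 for Q = sum_ij M_ij X_i X_j leaves
     V = sum_ij (2 + (kappa - 3) [i=j]) M_ij^2,
   where kappa = 1 for Rademacher and kappa = 3 for standard normal entries. *)
Require Import Defs.
From HB Require Import structures.
From mathcomp Require Import all_boot all_order all_algebra.
From mathcomp Require Import all_classical all_reals all_analysis.
From mathcomp Require Import measurable_realfun.
From mathcomp Require Import ring lra.

Set Implicit Arguments.
Unset Strict Implicit.
Unset Printing Implicit Defensive.

Import Order.TTheory GRing.Theory Num.Theory.
Import numFieldNormedType.Exports.

Local Open Scope ring_scope.

(** * Products of independent random variables *)

Section Density.
Local Open Scope classical_set_scope.
Local Open Scope ereal_scope.
Import HBNNSimple.

Lemma ge0_integral_density d d' (T : measurableType d) (T' : measurableType d')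
    (R : realType) (mu : {measure set T -> \bar R})
    (nu : {measure set T' -> \bar R}) (X : T -> T') (h : T -> R)
    (g : T' -> R) :
  measurable_fun setT X -> measurable_fun setT h -> (forall t, 0 <= h t)%R ->
  (forall B, measurable B -> nu B = \int[mu]_(t in X @^-1` B) (h t)%:E) ->
  measurable_fun setT g -> (forall y, 0 <= g y)%R ->
  \int[nu]_y (g y)%:E = \int[mu]_t (g (X t) * h t)%:E.
Proof.
move=> mX mh h0 nuE mg g0.
have mXB B : measurable B -> measurable (X @^-1` B).
  by move=> mB; rewrite -[X in measurable X]setTI; exact: mX.
move/measurable_EFinP: (mg) => mgE.
pose s := nnsfun_approx (@measurableT _ T') mgE.
have sg y : (EFin \o s n) y @[n --> \oo] --> (g y)%:E.
  by apply: (cvg_nnsfun_approx _ mgE) => // z _; rewrite lee_fin.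
have snd y a b : (a <= b)%N -> (s a y <= s b y)%R.
  by move=> ab; exact/lefP/nd_nnsfun_approx.
have -> : \int[nu]_y (g y)%:E = limn (fun n => \int[nu]_y (s n y)%:E).
  under eq_integral do rewrite -(cvg_lim _ (sg _))//.
  apply: monotone_convergence => //.
  - by move=> n; exact/measurable_EFinP.
  - by move=> n x _; rewrite lee_fin.
  - by move=> x _ a b ab; rewrite lee_fin snd.
have -> : \int[mu]_t (g (X t) * h t)%:E =
    limn (fun n => \int[mu]_t (s n (X t) * h t)%:E).
  have gh t : (s n (X t) * h t)%:E @[n --> \oo] --> (g (X t) * h t)%:E.
    under eq_fun do rewrite EFinM.
    by rewrite EFinM; apply: cvgeZr => //; exact: sg.
  under eq_integral do rewrite -(cvg_lim _ (gh _))//.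
  apply: monotone_convergence => //.
  - move=> n; apply/measurable_EFinP/measurable_funM => //.
    exact: measurableT_comp.
  - by move=> n x _; rewrite lee_fin mulr_ge0.
  - by move=> x _ a b ab; rewrite lee_fin ler_wpM2r// snd.
congr (limn _); apply/funext => n.
under eq_integral do rewrite fimfunE -fsumEFin//.
rewrite ge0_integral_fsum//; last 2 first.
- move=> r; apply/measurable_EFinP/measurable_funM => //.
- by move=> r y _; exact: nnfun_muleindic_ge0.
under [RHS]eq_integral => t _.
  rewrite EFinM fimfunE -fsumEFin// ge0_mule_fsuml; last first.
    by move=> r; exact: nnfun_muleindic_ge0.
  over.
rewrite ge0_integral_fsum//; last 2 first.
- move=> r; apply/measurable_EFinP/measurable_funM => //.
  apply: measurable_funM => //; apply: measurableT_comp => //.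
- move=> r y _; apply: mule_ge0; last by rewrite lee_fin.
  exact: nnfun_muleindic_ge0.
apply: eq_fsbigr => r /[!inE] -[y0 _ <-].
set B := s n @^-1` _.
have mB : measurable B by exact: measurable_funPTI.
under eq_integral do rewrite EFinM.
rewrite ge0_integralZl//; last 2 first.
- exact/measurable_EFinP.
- by rewrite lee_fin.
rewrite integral_indic// setIT nuE//.
under [RHS]eq_integral do rewrite EFinM -muleA.
rewrite ge0_integralZl//; last 3 first.
- apply/measurable_EFinP/measurable_funM => //.
  exact: measurableT_comp.
- by move=> t _; rewrite mule_ge0 ?lee_fin.
- by rewrite lee_fin.
congr (_ * _).
rewrite integral_mkcond; apply: eq_integral => t _.
by rewrite epatch_indic muleC.
Qed.

End Density.

(* The members of the family are upgraded from G0 to G1 one index at a time. *)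
Lemma family_ind (I : finType) (V : Type) (C : {set I}) (G0 G1 : I -> V -> Prop)
    (Phi : (I -> V) -> Prop) :
  (forall i a, G0 i a -> G1 i a) ->
  (forall u, (forall i, i \in C -> G0 i (u i)) -> Phi u) ->
  (forall u k, k \in C -> (forall i, i \in C -> G1 i (u i)) ->
     (forall a, G0 k a -> Phi (fun i => if i == k then a else u i)) -> Phi u) ->
  forall u, (forall i, i \in C -> G1 i (u i)) -> Phi u.
Proof.
move=> G01 base step u uG1.
have [m] := ubnP #|C|; have : forall i, i \in C -> i \notin C -> G0 i (u i).
  by move=> i ->.
move: {3 4}C (uG1) => K; elim: m => // m IHm in K u uG1 *.
move=> _ uG0; rewrite ltnS => Km.
have [KC0|[k]] := set_0Vmem (K :&: C).
  apply: base => i iC; apply: uG0 => //; apply/negP => iK.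
  by move/finset.setP/(_ i): KC0; rewrite !inE iK iC.
rewrite inE => /andP[kK kC]; apply: (step u k) => // a Ga.
have aG1 i : i \in C -> G1 i (if i == k then a else u i).
  by move=> iC; case: eqVneq => [->|_]; [exact: G01|exact: uG1].
apply: (IHm (K :\ k)) => //; last by rewrite (finset.cardsD1 k K) kK in Km.
move=> i iC; rewrite !inE; case: eqVneq => [->|_] //= iK.
exact: uG0.
Qed.

Section Independence.
Local Open Scope ereal_scope.
Local Open Scope ring_scope.
Local Open Scope classical_set_scope.
Context d (T : measurableType d) (R : realType) (P : probability T R).
Variables (I : finType) (C : {set I}) (X : I -> {RV P >-> R}).
Hypothesis X_indep : mutually_independent C X.

Let expectation_prodP (u : I -> R -> R) : Prop :=
  P.-integrable setT (fun t => (\prod_(i in C) u i (X i t))%:E) /\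
  'E_P[fun t => \prod_(i in C) u i (X i t)] =
    (\prod_(i in C) fine 'E_P[fun t => u i (X i t)])%:E.

Let is_indic (i : I) (g : R -> R) := exists2 B, measurable B & g = \1_B.

Let ge0_integrable (i : I) (g : R -> R) := [/\ measurable_fun setT g,
  forall x, 0 <= g x & P.-integrable setT (fun t => (g (X i t))%:E)].

Let integrable_at (i : I) (g : R -> R) := measurable_fun setT g /\
  P.-integrable setT (fun t => (g (X i t))%:E).

Lemma measurable_RV_preimage (Y : {RV P >-> R}) B :
  measurable B -> measurable (Y @^-1` B).
Proof. by move=> mB; exact: measurable_funPTI. Qed.

Let expectation_prod_indic u : (forall i, i \in C -> is_indic i (u i)) ->
  expectation_prodP u.
Proof.
move=> uI; pose B i := [set y | u i y = 1].
have uB i : i \in C -> measurable (B i) /\ u i = \1_(B i).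
  move=> /uI[D mD uD]; suff -> : B i = D by [].
  apply/seteqP; split => y; rewrite /B /= uD indicE.
    by case: (boolP (y \in D)) => [/set_mem//|_ /eqP]; rewrite eq_sym oner_eq0.
  by move=> /mem_set ->.
pose E := \bigcap_(i in [set` C]) (X i @^-1` B i).
have mE : measurable E.
  apply: fin_bigcap_measurable; first exact: finite_finset.
  by move=> i /= iC; apply: measurable_RV_preimage; case: (uB _ iC).
have prodE : (fun t => \prod_(i in C) u i (X i t)) = \1_E.
  apply/funext => t; rewrite indicE; have [tE|tE] := boolP (t \in E).
    rewrite big1// => i iC; case: (uB _ iC) => _ ->.
    by rewrite indicE mem_set//; move/set_mem: tE => /(_ _ iC).
  have [i iC tBi] : exists2 i, i \in C & ~ B i (X i t).
    apply/not_exists2P => tB; move/negP: tE; apply; apply/mem_set => i iC.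
    by case: (tB i) => // /contrapT.
  rewrite (bigD1 i)//=; case: (uB _ iC) => _ ->.
  by rewrite indicE memNset// mul0r.
split.
  rewrite [X in P.-integrable _ X](_ : _ = EFin \o \1_E); last by rewrite -prodE.
  exact: integrable_indic.
rewrite prodE expectation_indic// X_indep//; last by move=> i /uB[].
rewrite -prodEFin; apply: eq_bigr => i iC; case: (uB _ iC) => mBi ->.
rewrite -[X in 'E_P[X]]/(\1_(X i @^-1` B i)) expectation_indic.
  by rewrite fineK// fin_num_measure//; exact: measurable_RV_preimage.
exact: measurable_RV_preimage.
Qed.

Let split_prod (u : I -> R -> R) k a (t : T) : k \in C ->
  \prod_(i in C) (if i == k then a else u i) (X i t) =
  a (X k t) * \prod_(i in C | i != k) u i (X i t).
Proof.
move=> kC; rewrite (bigD1 k)//= eqxx; congr (_ * _).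
by apply: eq_bigr => i /andP[_ /negbTE ->].
Qed.

Let split_prodE (u : I -> R -> R) k a : k \in C ->
  \prod_(i in C) fine 'E_P[fun t => (if i == k then a else u i) (X i t)] =
  fine 'E_P[fun t => a (X k t)] *
    \prod_(i in C | i != k) fine 'E_P[fun t => u i (X i t)].
Proof.
move=> kC; rewrite (bigD1 k)//= eqxx; congr (_ * _).
by apply: eq_bigr => i /andP[_ /negbTE ->].
Qed.

Let expectation_prod_ge0 u : (forall i, i \in C -> ge0_integrable i (u i)) ->
  expectation_prodP u.
Proof.
apply: family_ind expectation_prod_indic _ u => [i _ [B mB ->]|u k kC uG IH].
  split; [exact: measurable_indic|by []|].
  rewrite (_ : (fun _ => _) = (EFin \o \1_(X i @^-1` B)))//.
  by apply: integrable_indic; exact: measurable_RV_preimage.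
pose h t := \prod_(i in C | i != k) u i (X i t).
pose c := \prod_(i in C | i != k) fine 'E_P[fun t => u i (X i t)].
have h0 t : 0 <= h t.
  by apply: prodr_ge0 => i /andP[/uG[]].
have c0 : 0 <= c.
  apply: prodr_ge0 => i /andP[/uG[_ u0 _] _]; apply: fine_ge0.
  exact: expectation_ge0.
have mh : measurable_fun setT h.
  rewrite /h; under eq_fun do rewrite -big_filter.
  apply: measurable_prod => i; rewrite mem_filter => /andP[/andP[/uG[mu _ _] _] _].
  exact: measurableT_comp.
have [mu u0 ui] := uG _ kC.
(* Replacing u k by indicators shows that h dP has image c times the law of X k. *)
have hE B : measurable B ->
    mscale (NngNum c0) (distribution P (X k)) B =
    (\int[P]_(t in X k @^-1` B) (h t)%:E)%E.
  move=> mB; have mXB := measurable_RV_preimage (X k) mB.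
  have [_] := IH \1_B (ex_intro2 _ _ B mB erefl).
  have E1 : 'E_P[fun t => \1_B (X k t) : R] = P (X k @^-1` B).
    exact: (expectation_indic P mXB).
  rewrite split_prodE// -/c E1 EFinM fineK ?fin_num_measure// muleC => EP.
  transitivity (c%:E * P (X k @^-1` B))%E; first by [].
  rewrite -EP unlock [RHS]integral_mkcond; apply: eq_integral => t _.
  by rewrite split_prod// epatch_indic EFinM muleC.
have key := ge0_integral_density (@measurable_funPT _ _ _ _ (X k)) mh h0 hE mu u0.
rewrite ge0_integral_mscale//= in key; last 2 first.
- exact/measurable_EFinP.
- by move=> x _; rewrite lee_fin.
rewrite ge0_integral_distribution// in key; last first.
  exact/measurable_EFinP.
have prodE t : \prod_(i in C) u i (X i t) = u k (X k t) * h t.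
  by rewrite (bigD1 k).
have EE : 'E_P[fun t => \prod_(i in C) u i (X i t)] =
    (\prod_(i in C) fine 'E_P[fun t => u i (X i t)])%:E.
  rewrite (bigD1 k)//= -/c unlock; under eq_integral do rewrite prodE.
  rewrite -key mulrC EFinM fineK//.
  exact: integrable_fin_num.
split => //; apply/integrableP; split.
  apply/measurable_EFinP; under eq_fun do rewrite prodE.
  by apply: measurable_funM => //; exact: measurableT_comp.
under eq_integral => t _.
  rewrite gee0_abs ?lee_fin; last by rewrite prodr_ge0// => i /uG[].
  over.
by rewrite unlock in EE; rewrite EE ltry.
Qed.

Lemma expectation_prod u :
  (forall i, i \in C -> measurable_fun setT (u i)) ->
  (forall i, i \in C -> P.-integrable setT (fun t => (u i (X i t))%:E)) ->
  P.-integrable setT (fun t => (\prod_(i in C) u i (X i t))%:E) /\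
  'E_P[fun t => \prod_(i in C) u i (X i t)] =
    (\prod_(i in C) fine 'E_P[fun t => u i (X i t)])%:E.
Proof.
move=> mu ui; have {mu ui} : forall i, i \in C -> integrable_at i (u i).
  by move=> i iC; split; [exact: mu|exact: ui].
apply: family_ind expectation_prod_ge0 _ u => [i a [ma _ ai]//|u k kC uG IH].
have [mu ui] := uG _ kC.
have pG : ge0_integrable k (u k)^\+%R.
  split; [exact: measurable_funrpos|by []|].
  exact: (integrable_funrpos measurableT ui).
have nG : ge0_integrable k (u k)^\-%R.
  split; [exact: measurable_funrneg|by []|].
  exact: (integrable_funrneg measurableT ui).
have [pI pE] := IH _ pG; have [nI nE] := IH _ nG.
have prodE t : \prod_(i in C) u i (X i t) =
    \prod_(i in C) (if i == k then (u k)^\+%R else u i) (X i t) -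
    \prod_(i in C) (if i == k then (u k)^\-%R else u i) (X i t).
  by rewrite !split_prod// -mulrBl (bigD1 k)//= -[in LHS](funrposBneg (u k)).
have uE : fine 'E_P[fun t => u k (X k t)] =
    fine 'E_P[fun t => (u k)^\+%R (X k t)] -
    fine 'E_P[fun t => (u k)^\-%R (X k t)].
  case: pG nG => _ _ pi [_ _ ni]; rewrite unlock -fineB ?integrable_fin_num//.
  rewrite -integralB//; congr fine; apply: eq_integral => t _.
  by rewrite -[in LHS](funrposBneg (u k)) EFinB.
split.
  under eq_fun do rewrite prodE EFinB.
  exact: integrableB.
rewrite (bigD1 k)//= uE mulrBl EFinB -!split_prodE// -pE -nE unlock -integralB//.
by apply: eq_integral => t _; rewrite prodE EFinB.
Qed.

End Independence.

(** * Variance of a quadratic form in independent variables *)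

Section QuadraticFormVariance.
Local Open Scope ereal_scope.
Local Open Scope ring_scope.
Context d (T : measurableType d) (R : realType) (P : probability T R).

Lemma expectation_lincomb (J : Type) (s : seq J) (D : pred J) (c e : J -> R)
    (F : J -> T -> R) :
  (forall j, D j -> P.-integrable setT (EFin \o F j) /\ 'E_P[F j] = (e j)%:E) ->
  P.-integrable setT (fun t => (\sum_(j <- s | D j) c j * F j t)%:E) /\
  'E_P[fun t => \sum_(j <- s | D j) c j * F j t] =
    (\sum_(j <- s | D j) c j * e j)%:E.
Proof.
move=> DF; elim: s => [|j s [IHi IHE]].
  rewrite big_nil; under eq_fun do rewrite big_nil; split; first exact: integrable0.
  rewrite (_ : (fun _ => _) = cst 0) ?expectation_cst//.
  by apply/funext => t; rewrite big_nil.
have [Dj|nDj] := boolP (D j); last first.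
  rewrite big_cons (negbTE nDj).
  by split; [under eq_fun do rewrite big_cons (negbTE nDj)|
    under eq_fun do rewrite big_cons (negbTE nDj)].
have [iFj EFj] := DF _ Dj; rewrite big_cons Dj.
have icF : P.-integrable setT (fun t => (c j * F j t)%:E).
  by under eq_fun do rewrite EFinM; exact: integrableZl.
split.
  under eq_fun do rewrite big_cons Dj EFinD.
  exact: integrableD.
under eq_fun do rewrite big_cons Dj.
by rewrite EFinD -IHE EFinM -EFj !expectation.unlock -integralZl// -integralD.
Qed.

Lemma integrable_expr_le4 (Y : T -> R) k : measurable_fun setT Y -> (k <= 4)%N ->
  P.-integrable setT (fun t => (Y t ^+ 4)%:E) ->
  P.-integrable setT (fun t => (Y t ^+ k)%:E).
Proof.
move=> mY k4 iY4.
apply: (@le_integrable _ _ _ P _ _ _ (fun t => (1 + Y t ^+ 4)%:E)) => //.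
- by apply/measurable_EFinP; exact: measurable_funX.
- move=> t _; rewrite !abse_EFin lee_fin normrX.
  rewrite [leRHS]ger0_norm ?addr_ge0 ?exprn_even_ge0//.
  have -> : Y t ^+ 4 = `|Y t| ^+ 4 by rewrite -normrX ger0_norm ?exprn_even_ge0.
  have [Y1|Y1] := leP `|Y t| 1.
    by apply: ler_wpDr; [exact: exprn_ge0|exact: exprn_ile1].
  by apply: ler_wpDl => //; apply: ler_weXn2l => //; exact: ltW.
- under eq_fun do rewrite EFinD; apply: integrableD => //.
  exact: finite_measure_integrable_cst.
Qed.

Variables (I : finType) (C : {set I}) (X : I -> {RV P >-> R}) (kappa : R).
Hypothesis X_indep : mutually_independent C X.
Hypothesis X4_integrable : forall i, i \in C ->
  P.-integrable setT (fun t => (X i t ^+ 4)%:E).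
Hypothesis X_mean : forall i, i \in C -> 'E_P[X i] = 0%E.
Hypothesis X_sqr : forall i, i \in C -> 'E_P[fun t => X i t ^+ 2] = 1%E.
Hypothesis X_fourth : forall i, i \in C -> 'E_P[fun t => X i t ^+ 4] = kappa%:E.

Let moment a k := fine 'E_P[fun t => X a t ^+ k].

Let moment0 a : moment a 0 = 1.
Proof. by rewrite /moment (_ : (fun _ => _) = cst 1)// expectation_cst. Qed.

Let moment1 a : a \in C -> moment a 1 = 0.
Proof. by move=> aC; have := X_mean aC; rewrite /moment => ->. Qed.

Let moment2 a : a \in C -> moment a 2 = 1.
Proof. by move=> aC; rewrite /moment X_sqr. Qed.

Let moment4 a : a \in C -> moment a 4 = kappa.
Proof. by move=> aC; rewrite /moment X_fourth. Qed.

Let expectation_monomial (k : I -> nat) : (forall a, k a <= 4)%N ->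
  P.-integrable setT (fun t => (\prod_(a in C) X a t ^+ k a)%:E) /\
  'E_P[fun t => \prod_(a in C) X a t ^+ k a] =
    (\prod_(a in C) moment a (k a))%:E.
Proof.
move=> k4; apply: (expectation_prod X_indep (u := fun a x => x ^+ k a)) => // a aC.
by apply: integrable_expr_le4 => //; exact: X4_integrable.
Qed.

Let prod_expr_eq i t : i \in C -> \prod_(a in C) X a t ^+ (a == i) = X i t.
Proof.
move=> iC; rewrite (bigD1 i)//= eqxx expr1 big1 ?mulr1// => a /andP[_ /negbTE ->].
by rewrite expr0.
Qed.

Let expectation2 (p : I * I) : p.1 \in C -> p.2 \in C ->
  P.-integrable setT (fun t => (X p.1 t * X p.2 t)%:E) /\
  'E_P[fun t => X p.1 t * X p.2 t] = (p.1 == p.2)%:R%:E.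
Proof.
case: p => i j /= iC jC.
pose k (a : I) := ((a == i) + (a == j))%N.
have kE : (fun t => X i t * X j t) = (fun t => \prod_(a in C) X a t ^+ k a).
  apply/funext => t; rewrite -(prod_expr_eq t iC) -(prod_expr_eq t jC).
  by rewrite -big_split; apply: eq_bigr => a _; rewrite exprD.
have [] := @expectation_monomial k.
  by move=> a; rewrite /k; do 2!case: eqP.
rewrite -kE => iX ->; split.
  by rewrite (_ : (fun _ => _) = EFin \o (fun t => X i t * X j t))// kE.
congr _%:E; rewrite (bigD1 i)//= {1}/k eqxx.
have [ij|ij] := eqVneq i j.
  rewrite moment2// mul1r big1// => a /andP[_ /negbTE ai].
  by rewrite /k -ij ai moment0.
by rewrite moment1// mul0r.
Qed.

Let expectation4 (p q : I * I) : p.1 \in C -> p.2 \in C -> q.1 \in C -> q.2 \in C ->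
  P.-integrable setT (fun t => (X p.1 t * X p.2 t * (X q.1 t * X q.2 t))%:E) /\
  'E_P[fun t => X p.1 t * X p.2 t * (X q.1 t * X q.2 t)] =
    ((p.1 == p.2)%:R * (q.1 == q.2)%:R + (q == p)%:R + (q == (p.2, p.1))%:R +
     (kappa - 3) * (p.1 == p.2)%:R * (q == p)%:R)%:E.
Proof.
case: p q => i j [r s] /= iC jC rC sC.
pose k (a : I) := ((a == i) + (a == j) + ((a == r) + (a == s)))%N.
have kE : (fun t => X i t * X j t * (X r t * X s t)) =
    (fun t => \prod_(a in C) X a t ^+ k a).
  apply/funext => t; rewrite -(prod_expr_eq t iC) -(prod_expr_eq t jC).
  rewrite -(prod_expr_eq t rC) -(prod_expr_eq t sC).
  by rewrite -!big_split; apply: eq_bigr => a _; rewrite !exprD.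
have [] := @expectation_monomial k.
  by move=> a; rewrite /k; do 4!case: eqP.
rewrite -kE => iX ->; split.
  rewrite (_ : (fun _ => _) =
    EFin \o (fun t => X i t * X j t * (X r t * X s t)))//.
  by rewrite kE.
congr _%:E; rewrite !xpair_eqE.
have single a : a \in C -> k a = 1%N -> \prod_(b in C) moment b (k b) = 0.
  by move=> aC ka; rewrite (bigD1 a)//= ka moment1// mul0r.
have quadruple a : a \in C -> k a = 4%N ->
    (forall b, b != a -> k b = 0%N) -> \prod_(b in C) moment b (k b) = kappa.
  move=> aC ka kb; rewrite (bigD1 a)//= ka moment4// big1 ?mulr1// => b.
  by move=> /andP[_ /kb ->].
have pair a b : a \in C -> b \in C -> b != a -> k a = 2%N -> k b = 2%N ->
    (forall c, c != a -> c != b -> k c = 0%N) ->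
    \prod_(c in C) moment c (k c) = 1.
  move=> aC bC ba ka kb kc; rewrite (bigD1 a)//= ka moment2//.
  rewrite (bigD1 b) ?bC//= kb moment2// big1 ?mulr1// => c.
  by move=> /andP[/andP[_ ca] cb]; rewrite kc// moment0.
have [ij|ij] := eqVneq i j; have [rs|rs] := eqVneq r s.
- subst j s; have [ri|ri] := eqVneq r i.
    subst r; rewrite (quadruple i) //=; [by ring|by rewrite /k eqxx|].
    by move=> b /negbTE bi; rewrite /k bi.
  rewrite (pair i r) //=; first by ring.
  + by rewrite /k eqxx (eq_sym i r) (negbTE ri).
  + by rewrite /k eqxx (negbTE ri).
  + by move=> c /negbTE ci /negbTE cr; rewrite /k ci cr.
- subst j; have [ri|ri] := eqVneq r i.
    subst r; rewrite (single s) //=; last first.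
      by rewrite /k eqxx (eq_sym s i) (negbTE rs).
    by rewrite (eq_sym s i) (negbTE rs) /=; ring.
  rewrite (single r) //=; first by ring.
  by rewrite /k eqxx (negbTE ri) (negbTE rs).
- subst s; have [ri|ri] := eqVneq r i.
    subst r; rewrite (single j) //=; last first.
      by rewrite /k eqxx (eq_sym j i) (negbTE ij).
    by rewrite (negbTE ij) /=; ring.
  rewrite (single i) //=; last first.
    by rewrite /k eqxx (eq_sym i r) (negbTE ij) (negbTE ri).
  by rewrite andbF /=; ring.
have ji : j != i by rewrite eq_sym.
have [ri|ri] := eqVneq r i; last have [rj|rj] := eqVneq r j.
- subst r; rewrite ?(negbTE ij) /=; have [sj|sj] := eqVneq s j.
    subst s; rewrite (pair i j) //=; last 3 first.
    + by rewrite /k eqxx (negbTE ij).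
    + by rewrite /k eqxx (eq_sym j i) (negbTE ij).
    + by move=> c /negbTE ci /negbTE cj; rewrite /k ci cj.
    + by rewrite /=; ring.
  rewrite (single j) //=; first by ring.
  by rewrite /k eqxx (eq_sym j i) (eq_sym j s) (negbTE ij) (negbTE sj).
- subst r; have [si|si] := eqVneq s i.
    subst s; rewrite (pair i j) //=; last 3 first.
    + by rewrite /k eqxx (negbTE ij).
    + by rewrite /k eqxx (eq_sym j i) (negbTE ij).
    + by move=> c /negbTE ci /negbTE cj; rewrite /k ci cj.
    + by rewrite /=; ring.
  rewrite (single i) //=; first by ring.
  by rewrite /k eqxx (eq_sym i s) (negbTE ij) (negbTE si).
- rewrite (single r) //=; first by ring.
  by rewrite /k eqxx (negbTE ri) (negbTE rj) (negbTE rs).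
Qed.

Lemma variance_quadratic (M : I -> I -> R) : (forall i j, M i j = M j i) ->
  'V_P[fun t => \sum_(i in C) \sum_(j in C) M i j * (X i t * X j t)] =
  (\sum_(i in C) \sum_(j in C) (2 + (kappa - 3) * (i == j)%:R) * M i j ^+ 2)%:E.
Proof.
move=> Msym; pose D := [pred p : I * I | (p.1 \in C) && (p.2 \in C)].
pose N (p : I * I) := M p.1 p.2; pose Y (p : I * I) t := X p.1 t * X p.2 t.
pose delta (p : I * I) : R := (p.1 == p.2)%:R.
pose D2 := [pred p : (I * I) * (I * I) | D p.1 && D p.2].
have QE : (fun t => \sum_(i in C) \sum_(j in C) M i j * (X i t * X j t)) =
    (fun t => \sum_(p | D p) N p * Y p t).
  by apply/funext => t; rewrite pair_big.
have QQE : (fun t => \sum_(p | D p) N p * Y p t) *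
    (fun t => \sum_(p | D p) N p * Y p t) =
    (fun t => \sum_(p | D2 p) (N p.1 * N p.2) * (Y p.1 t * Y p.2 t)).
  apply/funext => t; rewrite [LHS]big_distrlr/= pair_big/=.
  by apply: eq_bigr => p _; rewrite mulrACA.
have [iQ EQ] := @expectation_lincomb _ (index_enum _) D N delta Y
  (fun p pD => expectation2 (proj1 (andP pD)) (proj2 (andP pD))).
have D2P p : D2 p -> [/\ p.1.1 \in C, p.1.2 \in C, p.2.1 \in C & p.2.2 \in C].
  by move=> /andP[/andP[? ?] /andP[? ?]].
pose e4 (p : (I * I) * (I * I)) := delta p.1 * delta p.2 + (p.2 == p.1)%:R +
  (p.2 == (p.1.2, p.1.1))%:R + (kappa - 3) * delta p.1 * (p.2 == p.1)%:R.
have [iQQ EQQ] : P.-integrable setT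
      (fun t => (\sum_(p | D2 p) N p.1 * N p.2 * (Y p.1 t * Y p.2 t))%:E) /\
    'E_P[fun t => \sum_(p | D2 p) N p.1 * N p.2 * (Y p.1 t * Y p.2 t)] =
      (\sum_(p | D2 p) N p.1 * N p.2 * e4 p)%:E.
  apply: (@expectation_lincomb _ _ D2 (fun p => N p.1 * N p.2) e4
    (fun p t => Y p.1 t * Y p.2 t)) => p /D2P[? ? ? ?].
  exact: expectation4.
rewrite QE /variance covarianceE ?QQE; last 3 first.
- exact/Lfun1_integrable.
- exact/Lfun1_integrable.
- exact/Lfun1_integrable.
rewrite EQQ EQ -EFinM -EFinB; congr _%:E.
rewrite [RHS]pair_big/=.
have pick p : D p -> \sum_(q | D q) N q * (q == p)%:R = N p.
  move=> Dp; rewrite (bigD1 p)//= eqxx mulr1 big1 ?addr0// => q /andP[_ /negbTE ->].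
  by rewrite mulr0.
have -> : \sum_(p | D2 p) N p.1 * N p.2 * e4 p =
    \sum_(p | D p) \sum_(q | D q) N p * N q * e4 (p, q).
  by rewrite pair_big/=; apply: eq_bigr => -[].
apply/eqP; rewrite subr_eq addrC; apply/eqP.
rewrite [in RHS]mulr_suml -big_split/=; apply: eq_bigr => -[i j] Dp.
transitivity (N (i, j) * delta (i, j) * (\sum_(q | D q) N q * delta q) +
  (1 + (kappa - 3) * delta (i, j)) * N (i, j) *
    (\sum_(q | D q) N q * (q == (i, j))%:R) +
  N (i, j) * \sum_(q | D q) N q * (q == (j, i))%:R).
  rewrite !mulr_sumr -!big_split/=; apply: eq_bigr => q _.
  by rewrite /e4/=; ring.
rewrite !pick//; last by rewrite /D/= andbC.
rewrite (_ : N (j, i) = N (i, j)); last exact: Msym.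
by rewrite /N /delta/=; ring.
Qed.

End QuadraticFormVariance.

(** * Moments of the normal and Rademacher distributions *)

Section NormalMoments.
Local Open Scope classical_set_scope.
Local Open Scope ereal_scope.
Local Open Scope ring_scope.
Variable R : realType.
Local Notation mu := (@lebesgue_measure R).
Local Notation phi := (@normal_pdf R 0 1).

Lemma std_normal_pdfE : phi = fun x => normal_peak 1 * expR (- (x ^+ 2 / 2)).
Proof.
apply/funext => x; rewrite normal_pdfE ?oner_neq0// /normal_fun subr0 expr1n.
by rewrite mulNr mulr2n.
Qed.

Lemma std_normal_pdfN x : phi (- x) = phi x.
Proof. by rewrite std_normal_pdfE sqrrN. Qed.

Lemma is_derive_std_normal_pdf (x : R) : is_derive x 1 phi (- (x * phi x)).
Proof.
rewrite std_normal_pdfE.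
have dg : is_derive x (1 : R) (fun y : R => - (y ^+ 2 / 2)) (- x).
  rewrite (_ : (fun y => _) = - (2^-1 *: (@id R) ^+ 2)); last first.
    by apply/funext => y /=; rewrite !fctE mulrC.
  by apply: is_derive_eq; rewrite expr1 /GRing.scale/=; field.
have := @is_derive1_comp R expR (fun y => - (y ^+ 2 / 2)) x _ _
  (is_derive_expR _) dg.
move=> /(is_deriveZ (normal_peak 1)) H.
by apply: (is_derive_eq H); rewrite /GRing.scale/=; ring.
Qed.

Lemma continuous_std_normal_pdf : continuous phi.
Proof. by apply: continuous_normal_pdf; exact: oner_neq0. Qed.

Lemma cvg_exprn_std_normal_pdf k :
  (n%:R ^+ k.+1 * phi n%:R) @[n --> \oo] --> (0 : R).
Proof.
pose K : R := normal_peak 1 * (k.+1`!%:R * 2 ^+ k.+1).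
have K0 : 0 <= K by rewrite mulr_ge0 ?normal_peak_ge0// mulr_ge0// exprn_ge0.
apply: (@squeeze_cvgr _ _ _ _ (fun=> 0) (fun n => K * (n%:R)^-1)); last 2 first.
- exact: cvg_cst.
- rewrite -(mulr0 K); apply: cvgMr.
  apply/(@gtr0_cvgV0 _ _ \oo _ (fun n => n%:R : R)); last exact: cvgr_idn.
  by near=> n; rewrite ltr0n; near: n; exact: nbhs_infty_gt.
near=> n; have n0 : (0 < n)%N by near: n; exact: nbhs_infty_gt.
have n0R : 0 < n%:R :> R by rewrite ltr0n.
rewrite mulr_ge0 ?exprn_ge0 ?normal_pdf_ge0//= std_normal_pdfE.
pose y : R := n%:R ^+ 2 / 2.
have y0 : 0 < y by rewrite divr_gt0 ?exprn_gt0.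
have fact0 : 0 < k.+1`!%:R :> R by rewrite ltr0n fact_gt0.
have expy : y ^+ k.+1 / k.+1`!%:R <= expR y.
  by have := expR_ge1Dxn k (ltW y0); apply: le_trans; rewrite lerDr ler01.
apply: (@le_trans _ _ (K / n%:R ^+ k.+1)); last first.
  rewrite ler_wpM2l// lef_pV2 ?posrE ?exprn_gt0//.
  by rewrite ler_eXnr// ler1n.
have -> : K / n%:R ^+ k.+1 =
    n%:R ^+ k.+1 * (normal_peak 1 * (y ^+ k.+1 / k.+1`!%:R)^-1).
  rewrite /K /y expr_div_n exprAC.
  by field; rewrite ?gt_eqF ?exprn_gt0.
rewrite ler_wpM2l ?exprn_ge0// ler_wpM2l ?normal_peak_ge0// expRN.
by rewrite lef_pV2 ?posrE ?expR_gt0// divr_gt0 ?exprn_gt0.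
Unshelve. all: by end_near. Qed.

Lemma integral0_exprn_std_normal_pdf k n : (0 < n)%N ->
  (\int[mu]_(x in `[0%R, n%:R]) (x ^+ k.+2 * phi x)%:E =
   k.+1%:R%:E * \int[mu]_(x in `[0%R, n%:R]) (x ^+ k * phi x)%:E
   - (n%:R ^+ k.+1 * phi n%:R)%:E)%E.
Proof.
move=> n0.
(* Parts, with x^(k+2) phi = x^(k+1) (x phi) and (- phi)' = x phi. *)
pose F (x : R) := x ^+ k.+1; pose f (x : R) := k.+1%:R * x ^+ k.
pose G x := - phi x; pose g (x : R) := x * phi x.
have cX m : continuous (fun x : R => x ^+ m) by exact: exprn_continuous.
have cphi := continuous_std_normal_pdf.
have dF x : is_derive x (1 : R) F (f x).
  have -> : F = (@id R) ^+ k.+1 by apply/funext => y; rewrite !fctE.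
  by apply: is_derive_eq; rewrite /f /GRing.scale/= mulr1 mulr_natl.
have dG x : is_derive x (1 : R) G (g x).
  have H := is_deriveN (is_derive_std_normal_pdf x).
  by apply: (is_derive_eq H); rewrite opprK.
have dC (h h' : R -> R) : (forall x, is_derive x (1 : R) h (h' x)) -> continuous h.
  move=> dh x; apply: differentiable_continuous; apply/derivable1_diffP.
  by case: (dh x).
have LR (h h' : R -> R) : (forall x, is_derive x (1 : R) h (h' x)) ->
    derivable_oo_LRcontinuous h 0 n%:R.
  move=> dh; split; first by move=> x _; case: (dh x).
    by apply: cvg_at_right_filter; exact: (dC _ _ dh).
  by apply: cvg_at_left_filter; exact: (dC _ _ dh).
have n0R : (0 : R) < n%:R by rewrite ltr0n.
have /= := @integration_by_parts R F G f g 0 n%:R n0R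
  _ (LR _ _ dF) _ _ (LR _ _ dG) _.
have cf : continuous f by move=> x; apply: cvgMr; exact: cX.
have cg : continuous g by move=> x; apply: cvgM; [exact: cvg_id|exact: cphi].
rewrite /F expr0n/= mul0r subr0 => parts.
rewrite (_ : (fun x => (x ^+ k.+2 * phi x)%:E) =
    fun x => (x ^+ k.+1 * g x)%:E); last first.
  by apply/funext => x; rewrite /g exprSr mulrA.
rewrite parts; last 4 first.
- exact: continuous_subspaceT.
- by move=> x _; rewrite derive1E; have [] := dF x.
- exact: continuous_subspaceT.
- by move=> x _; rewrite derive1E; have [] := dG x.
rewrite (_ : (fun x => (f x * G x)%:E) =
    fun x => ((- k.+1%:R)%:E * (x ^+ k * phi x)%:E)%E); last first.
  by apply/funext => x; rewrite /f /G -EFinM; congr _%:E; ring.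
rewrite integralZl//; last first.
  apply: continuous_compact_integrable; first exact: segment_compact.
  by apply: continuous_subspaceT => x; apply: cvgM; [exact: cX|exact: cphi].
by rewrite /G mulrN !EFinN mulNe oppeK addeC.
Qed.

Lemma integralT_even_exprn_std_normal_pdf k : ~~ odd k ->
  (\int[mu]_x (x ^+ k.+2 * phi x)%:E =
   k.+1%:R%:E * \int[mu]_x (x ^+ k * phi x)%:E)%E.
Proof.
move=> k_even.
pose h j (x : R) := x ^+ j * phi x.
have h0 j : ~~ odd j -> forall x, 0 <= h j x.
  by move=> jeven x; rewrite mulr_ge0 ?exprn_even_ge0 ?normal_pdf_ge0.
have ch j : continuous (h j).
  by move=> x; apply: cvgM;
    [exact: exprn_continuous|exact: continuous_std_normal_pdf].
have half j : ~~ odd j -> (\int[mu]_x (h j x)%:E =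
    2%:E * \int[mu]_(x in `[0%R, +oo[) (h j x)%:E)%E.
  move=> jeven; rewrite ge0_symfun_integralT ?set_itvcy//; first exact: h0.
  by move=> x; rewrite /h/= std_normal_pdfN exprNn -signr_odd (negbTE jeven) mul1r.
rewrite !half ?negbK//; rewrite muleCA; congr (_ * _)%E.
have cvh j : ~~ odd j -> _ := fun jeven =>
  ge0_cvgn_integral (mu := mu) (h0 _ jeven) (continuous_measurable_fun (ch j)).
have := cvh k.+2 _; rewrite negbK => /(_ k_even) /cvg_lim <-//.
apply/cvg_lim => //.
have -> : (k.+1%:R%:E * \int[mu]_(x in `[0%R, +oo[) (h k x)%:E =
   k.+1%:R%:E * \int[mu]_(x in `[0%R, +oo[) (h k x)%:E - 0%:E)%E.
  by rewrite sube0.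
apply: (@cvg_trans _ ((k.+1%:R%:E * \int[mu]_(x in `[0%R, n%:R]) (h k x)%:E -
   (n%:R ^+ k.+1 * phi n%:R)%:E)%E @[n --> \oo])).
  apply: near_eq_cvg; near=> n; apply/esym/integral0_exprn_std_normal_pdf.
  by near: n; exact: nbhs_infty_gt.
apply: cvgeB.
- by rewrite fin_num_adde_defl.
- by apply: cvgeZl => //; exact: cvh.
- apply: cvg_EFin; first by near=> n.
  exact: cvg_exprn_std_normal_pdf.
Unshelve. all: by end_near. Qed.

End NormalMoments.

Section ProbingMoments.
Local Open Scope classical_set_scope.
Local Open Scope ereal_scope.
Local Open Scope ring_scope.
Context d (T : measurableType d) (R : realType) (P : probability T R).
Variable X : {RV P >-> R}.
Local Notation mu := (@lebesgue_measure R).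
Local Notation phi := (@normal_pdf R 0 1).

Lemma ge0_integral_standard_normal (g : R -> R) : standard_normal X ->
  measurable_fun setT g -> (forall x, 0 <= g x) ->
  (\int[P]_t (g (X t))%:E = \int[mu]_x (g x * phi x)%:E)%E.
Proof.
move=> XN mg g0.
rewrite -(ge0_integral_distribution X (f := EFin \o g)); last 2 first.
- exact/measurable_EFinP.
- by move=> x; rewrite lee_fin.
have := @ge0_integral_density _ _ _ _ _ mu (distribution P X) id phi g.
apply=> //.
- exact: measurable_normal_pdf.
- by move=> x; exact: normal_pdf_ge0.
Qed.

Lemma standard_normal_even_moment k : standard_normal X -> ~~ odd k ->
  'E_P[fun t => X t ^+ k.+2] = (k.+1%:R%:E * 'E_P[fun t => (X t ^+ k)%R])%E.
Proof.
move=> XN keven; rewrite unlock.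
rewrite !(ge0_integral_standard_normal (g := fun x => x ^+ _))//.
- exact: integralT_even_exprn_std_normal_pdf.
- by move=> x; rewrite exprn_even_ge0.
- by move=> x; rewrite exprn_even_ge0//= negbK.
Qed.

Lemma standard_normal_sqr : standard_normal X -> 'E_P[fun t => X t ^+ 2] = 1%E.
Proof.
move=> XN; rewrite standard_normal_even_moment//.
by rewrite (_ : (fun _ => _) = cst 1)// expectation_cst mule1.
Qed.

Lemma standard_normal_fourth : standard_normal X ->
  'E_P[fun t => X t ^+ 4] = 3%:E.
Proof.
by move=> XN; rewrite standard_normal_even_moment// standard_normal_sqr// mule1.
Qed.

Lemma standard_normal_integrable4 : standard_normal X ->
  P.-integrable setT (fun t => (X t ^+ 4)%:E).
Proof.
move=> XN; apply/integrableP; split.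
  by apply/measurable_EFinP; exact: measurable_funX.
under eq_integral do rewrite gee0_abs ?lee_fin ?exprn_even_ge0//.
have := standard_normal_fourth XN; rewrite unlock => ->.
exact: ltry.
Qed.

Lemma standard_normal_mean : standard_normal X -> 'E_P[X] = 0%E.
Proof.
move=> XN; have iX : P.-integrable setT (EFin \o X).
  exact: (@integrable_expr_le4 _ _ _ P X 1) (standard_normal_integrable4 XN).
have sym : (\int[P]_t (Num.max (X t) 0)%:E = \int[P]_t (Num.max (- X t) 0)%:E)%E.
  rewrite (@ge0_integral_standard_normal (fun x => Num.max x 0))//; last 2 first.
  - exact: measurable_maxr.
  - by move=> x; rewrite le_max lexx orbT.
  rewrite (@ge0_integral_standard_normal (fun x => Num.max (- x) 0))//; last 2 first.
  - exact: measurable_maxr.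
  - by move=> x; rewrite le_max lexx orbT.
  pose f (x : R) := (Num.max x 0 * phi x)%:E.
  transitivity (\int[pushforward mu (-%R : _ -> measurableTypeR R)]_x f x)%E.
    by apply: eq_measure_integral => A mA _; exact/esym/lebesgue_measureN.
  rewrite (@ge0_integral_pushforward _ _ (measurableTypeR R)
    (measurableTypeR R) R -%R _ mu setT f).
  - by apply: eq_integral => x _; rewrite /f/= std_normal_pdfN.
  - exact: oppr_measurable.
  - exact: measurableT.
  - apply/measurable_EFinP/measurable_funM; first exact: measurable_maxr.
    exact: measurable_normal_pdf.
  - by move=> x _; rewrite lee_fin mulr_ge0 ?normal_pdf_ge0// le_max lexx orbT.
have iXp : P.-integrable setT (fun t => (Num.max (X t) 0)%:E).
  exact: integrable_funrpos.
have iXn : P.-integrable setT (fun t => (Num.max (- X t) 0)%:E).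
  exact: integrable_funrneg.
rewrite unlock.
transitivity (\int[P]_t ((Num.max (X t) 0)%:E - (Num.max (- X t) 0)%:E))%E.
  apply: eq_integral => t _; rewrite -EFinB; congr _%:E.
  by have /(congr1 (@^~ t)) := funrposBneg X.
by rewrite integralB// sym subee// integrable_fin_num.
Qed.

Hypothesis XR : rademacher X.

Lemma integral_rademacher (g : R -> R) : measurable_fun setT g ->
  (\int[P]_t (g (X t))%:E = ((g 1 + g (- 1)) / 2)%:E)%E.
Proof.
move=> mg; case: XR => X1 XN1.
pose A := X @^-1` [set 1]; pose B := X @^-1` [set -1].
have mA : measurable A by exact: measurable_RV_preimage.
have mB : measurable B by exact: measurable_RV_preimage.
have PA : P A = (2^-1)%:E by exact: X1.
have PB : P B = (2^-1)%:E by exact: XN1.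
have AB : A `&` B = set0.
  apply/seteqP; split => t //= -[XA XB].
  have : 1 = -1 :> R by rewrite -[LHS]XA -[RHS]XB.
  by lra.
have PAB : P (~` (A `|` B)) = 0%E.
  rewrite probability_setC; last exact: measurableU.
  have -> : P (A `|` B) = (P A + P B)%E by exact: measureU.
  have half2 : 2^-1 + 2^-1 = 1 :> R by field.
  by rewrite PA PB -!EFinD half2 subrr.
transitivity (\int[P]_t (g 1 * \1_A t + g (- 1) * \1_B t)%:E)%E.
  apply: ae_eq_integral => //.
  - by apply/measurable_EFinP; exact: measurableT_comp.
  - apply/measurable_EFinP; apply: measurable_funD.
      exact: measurable_funM.
    exact: measurable_funM.
  - exists (~` (A `|` B)); split => //; first exact/measurableC/measurableU.
    apply: subsetC => t AtBt _; rewrite !indicE.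
    have [At|At] := pselect (A t).
      have nB : ~ B t by move=> Bt; have : (A `&` B) t by []; rewrite AB.
      by rewrite mem_set// memNset// mulr1 mulr0 addr0 (At : X t = 1).
    case: AtBt => // Bt.
    by rewrite memNset// mem_set// mulr0 mulr1 add0r (Bt : X t = -1).
under eq_integral do rewrite EFinD !EFinM.
rewrite integralD//; last 2 first.
- by apply: integrableZl => //; exact: integrable_indic.
- by apply: integrableZl => //; exact: integrable_indic.
rewrite !integralZl//; try exact: integrable_indic.
transitivity ((g 1)%:E * P A + (g (- 1))%:E * P B)%E.
  by rewrite !integral_indic// !setIT.
rewrite PA PB -!EFinM -EFinD.
by congr _%:E; rewrite mulrDl.
Qed.

Lemma rademacher_moment (k : nat) :
  'E_P[fun t => X t ^+ k] = ((1 + (-1) ^+ k) / 2)%:E.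
Proof. by rewrite unlock (@integral_rademacher (fun x => x ^+ k))// expr1n. Qed.

Lemma rademacher_integrable4 : P.-integrable setT (fun t => (X t ^+ 4)%:E).
Proof.
apply/integrableP; split.
  by apply/measurable_EFinP; exact: measurable_funX.
under eq_integral do rewrite gee0_abs ?lee_fin ?exprn_even_ge0//.
by have := rademacher_moment 4; rewrite unlock => ->; exact: ltry.
Qed.

End ProbingMoments.

(** * Matrix functions and Frobenius norms *)

Section MatrixSums.
Variable R : realType.

Lemma matfun_sym n (f : R -> R) (A : 'M[R]_n) : A^T = A ->
  (matfun f A)^T = matfun f A.
Proof.
move=> /spectral_decomposition_exists[Q [d AQ]].
by rewrite (matfunE f AQ) !trmx_mul trmxK tr_diag_mx mulmxA.
Qed.

Lemma frobenius_norm_sqr m n (M : 'M[R]_(m, n)) :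
  frobenius_norm M ^+ 2 = \sum_i \sum_j `|M i j| ^+ 2.
Proof.
rewrite sqr_sqrtr// sumr_ge0// => i _.
by rewrite sumr_ge0// => j _; exact: exprn_ge0.
Qed.

Lemma frobenius_principal_sqr n (C : {set 'I_n}) (M : 'M[R]_n) :
  frobenius_norm (principal_submx C M) ^+ 2 =
  \sum_(i in C) \sum_(j in C) `|M i j| ^+ 2.
Proof.
rewrite frobenius_norm_sqr [RHS]big_enum_val; apply: eq_bigr => i _.
by rewrite [RHS]big_enum_val; apply: eq_bigr => j _; rewrite mxE.
Qed.

Lemma frobenius_Off_principal_sqr n (C : {set 'I_n}) (M : 'M[R]_n) :
  frobenius_norm (Off (principal_submx C M)) ^+ 2 =
  \sum_(i in C) \sum_(j in C | i != j) `|M i j| ^+ 2.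
Proof.
rewrite frobenius_norm_sqr [RHS]big_enum_val; apply: eq_bigr => i _.
rewrite big_mkcondr/= [RHS]big_enum_val; apply: eq_bigr => j _.
rewrite !mxE (inj_eq enum_val_inj); case: eqVneq => //= _.
by rewrite normr0 expr0n.
Qed.

Lemma quadratic_form_probing d (T : measurableType d) (P : probability T R) n
    (C : {set 'I_n}) (X : 'I_n -> {RV P >-> R}) (M : 'M[R]_n) t :
  quadratic_form M (probing_vector C X t) =
  \sum_(i in C) \sum_(j in C) M i j * (X i t * X j t).
Proof.
have wE i : probing_vector C X t i 0 = if i \in C then X i t else 0.
  rewrite /probing_vector summxE; case: ifP => iC.
    rewrite (bigD1 i)//= !mxE !eqxx mulr1 big1 ?addr0// => j /andP[_ ji].
    by rewrite !mxE eq_sym (negbTE ji) mulr0.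
  rewrite big1// => j jC; rewrite !mxE.
  case: eqVneq => [ij|_]; last by rewrite mulr0.
  by rewrite ij jC in iC.
rewrite /quadratic_form mxE; under eq_bigr => j _ do rewrite mxE mulr_suml.
rewrite exchange_big/= [RHS]big_mkcond/=; apply: eq_bigr => i _.
rewrite mxE wE; case: ifP => iC; last by rewrite big1// => j _; rewrite !mul0r.
rewrite [RHS]big_mkcond/=; apply: eq_bigr => j _; rewrite wE.
by case: ifP => jC; [ring|rewrite mulr0].
Qed.

End MatrixSums.

Theorem theorem3p3 (R : realType) (d : measure_display) (T : measurableType d)
    (P : probability T R) (n m : nat) (A : 'M[R]_n) (f : R -> R)
    (C : 'I_m -> {set 'I_n}) (l : 'I_m) (X : 'I_n -> {RV P >-> R})
    (A_sym : A^T = A) (C_partition : is_indexed_partition C)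
    (X_iid : iid (C l) X) :
  let fA := matfun f A in
  let V := 'V_P[fun t => quadratic_form fA (probing_vector (C l) X t)] in
  ((forall i, i \in C l -> rademacher (X i)) ->
     V = (2 * frobenius_norm (Off (principal_submx (C l) fA)) ^+ 2)%:E /\
     V = (2 * \sum_(i in C l) \sum_(j in C l | i != j) `|fA i j| ^+ 2)%:E) /\
  ((forall i, i \in C l -> standard_normal (X i)) ->
     V = (2 * frobenius_norm (principal_submx (C l) fA) ^+ 2)%:E /\
     V = (2 * \sum_(i in C l) \sum_(j in C l) `|fA i j| ^+ 2)%:E).
Proof.
move=> fA V; have [X_indep _] := X_iid.
have fA_sym i j : fA i j = fA j i.
  by rewrite /fA -[in LHS](matfun_sym f A_sym) mxE.
rewrite frobenius_Off_principal_sqr frobenius_principal_sqr.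
have VE : V =
    'V_P[fun t => \sum_(i in C l) \sum_(j in C l) fA i j * (X i t * X j t)].
  by congr variance; apply/funext => t; rewrite quadratic_form_probing.
split=> XD.
- suff -> : V =
    (2 * \sum_(i in C l) \sum_(j in C l | i != j) `|fA i j| ^+ 2)%:E by [].
  rewrite VE (@variance_quadratic _ _ _ P _ _ X 1)//.
  + congr _%:E; rewrite mulr_sumr; apply: eq_bigr => i _.
    rewrite big_mkcondr mulr_sumr; apply: eq_bigr => j _.
    by case: eqVneq => _ /=; rewrite ?real_normK ?num_real//; ring.
  + by move=> i /XD; exact: rademacher_integrable4.
  + move=> i /XD XiR; have := rademacher_moment XiR 1; rewrite expr1 subrr mul0r.
    exact.
  + by move=> i /XD XiR; rewrite (rademacher_moment XiR 2); congr _%:E; field.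
  + by move=> i /XD XiR; rewrite (rademacher_moment XiR 4); congr _%:E; field.
- suff -> : V = (2 * \sum_(i in C l) \sum_(j in C l) `|fA i j| ^+ 2)%:E by [].
  rewrite VE (@variance_quadratic _ _ _ P _ _ X 3)//.
  + congr _%:E; rewrite mulr_sumr; apply: eq_bigr => i _.
    rewrite mulr_sumr; apply: eq_bigr => j _.
    by rewrite subrr mul0r addr0 real_normK ?num_real.
  + by move=> i /XD; exact: standard_normal_integrable4.
  + by move=> i /XD; exact: standard_normal_mean.
  + by move=> i /XD; exact: standard_normal_sqr.
  + by move=> i /XD; exact: standard_normal_fourth.
Qed.
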